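(* Let $G$ be a VPT graph and let $h\geq 4$. Then $G\in[h,2,1]\setminus[h-1,2,1]$ if and only if $\max_{C\in\mathcal{C}(G)}\chi(B(G/C))=h$. Moreover, for $h=3$ the implication ''if $\max_{C\in\mathcal{C}(G)}\chi(B(G/C))=3$ then $G\in[3,2,1]\setminus[2,2,1]$'' also holds.
   Context: All graphs are finite, simple and connected. A clique is a maximal complete set of vertices; $\mathcal{C}(G)$ is the set of cliques of $G$; $\chi$ denotes chromatic number. An $(h,s,t)$-representation of a graph $G$ is a collection of subtrees $(T_v)_{v\in V(G)}$ of a tree $T$ such that (i) $T$ has maximum degree at most $h$, (ii) every $T_v$ has maximum degree at most $s$, and (iii) two distinct vertices $v,w$ are adjacent in $G$ iff $T_v$ and $T_w$ have at least $t$ vertices in common. $[h,s,t]$ is the class of graphs having an $(h,s,t)$-representation, with $\infty$ meaning no restriction; VPT $=[\infty,2,1]$. For a clique $C$ of $G$, the branch graph $B(G/C)$ has vertex set the vertices of $V(G)\setminus C$ adjacent to some vertex of $C$, and two such vertices $v,w$ are adjacent in $B(G/C)$ iff (1) $vw\notin E(G)$; (2) some vertex of $C$ is adjacent to both; and (3) there exist $v',w'\in C$ with $v'$ adjacent to $v$ but not to $w$, and $w'$ adjacent to $w$ but not to $v$. *)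

(* Defs.v *)
From mathcomp Require Import all_boot.
Set Implicit Arguments. Unset Strict Implicit. Unset Printing Implicit Defensive.

(* A graph G is a symmetric irreflexive relation e on a finType T. *)

Definition is_tree (n : nat) (f : rel 'I_n) : Prop :=
  [/\ symmetric f, irreflexive f, 0 < n,
      (forall x y, connect f x y) &
      ~ (exists c : seq 'I_n, 3 <= size c /\ ucycle f c)].

Definition rel_in (U : finType) (f : rel U) (S : {set U}) : rel U :=
  [rel a b | [&& a \in S, b \in S & f a b]].

Definition is_subtree (U : finType) (f : rel U) (S : {set U}) : Prop :=
  S != set0 /\ (forall x y, x \in S -> y \in S -> connect (rel_in f S) x y).

(* (h,s,t)-representation; h = None means h = infinity. *)
Definition has_rep (T : finType) (e : rel T) (h : option nat) (s t : nat) : Prop :=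
  exists n (f : rel 'I_n) (Tv : T -> {set 'I_n}),
    [/\ is_tree f,
        (if h is Some k then forall x, #|[set y | f x y]| <= k else True),
        (forall v, is_subtree f (Tv v)),
        (forall v x, x \in Tv v -> #|[set y in Tv v | f x y]| <= s) &
        (forall v w, v != w -> (e v w <-> t <= #|Tv v :&: Tv w|))].

Definition VPT (T : finType) (e : rel T) : Prop := has_rep e None 2 1.

Definition complete (T : finType) (e : rel T) (C : {set T}) : bool :=
  [forall x in C, forall y in C, (x != y) ==> e x y].

Definition is_clique (T : finType) (e : rel T) (C : {set T}) : bool :=
  complete e C && [forall D : {set T}, (C \proper D) ==> ~~ complete e D].

Definition Bset (T : finType) (e : rel T) (C : {set T}) : {set T} :=
  [set v | (v \notin C) && [exists c in C, e c v]].

Definition Brel (T : finType) (e : rel T) (C : {set T}) : rel T :=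
  [rel v w | [&& v != w, ~~ e v w,
                 [exists c in C, e c v && e c w],
                 [exists v' in C, e v' v && ~~ e v' w] &
                 [exists w' in C, e w' w && ~~ e w' v]]].

Definition colorable (T : finType) (A : {set T}) (r : rel T) (k : nat) : bool :=
  [exists c : {ffun T -> 'I_k},
     [forall x in A, forall y in A, ((x != y) && r x y) ==> (c x != c y)]].

Lemma colorable_ex (T : finType) (A : {set T}) (r : rel T) :
  exists k, colorable A r k.
Proof.
exists #|T|; apply/existsP; exists [ffun x => enum_rank x].
apply/forallP => x; apply/implyP => _; apply/forallP => y; apply/implyP => _.
apply/implyP => /andP [nxy _]; rewrite !ffunE inj_eq //; exact: enum_rank_inj.
Qed.

Definition chi (T : finType) (A : {set T}) (r : rel T) : nat :=
  ex_minn (colorable_ex A r).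

Definition max_chi_branch (T : finType) (e : rel T) : nat :=
  \max_(C : {set T} | is_clique e C) chi (Bset e C) (Brel e C).

(* Main.v *)
Require Import Defs.
From mathcomp Require Import all_boot.
Set Implicit Arguments. Unset Strict Implicit. Unset Printing Implicit Defensive.

(** Let [M] be the maximum of the chromatic numbers of the branch graphs.

    [G \in [h,2,1]] implies [M <= h]: by the Helly property a clique [C] is the
    set of all vertices whose path passes through some tree node [q].  Colour a
    vertex outside [C] by the component of [T - q] containing its path.  If two
    vertices of the same colour were adjacent in [B(G/C)], the median of [q] and
    of the nodes of the two paths closest to [q] would be a node of degree at
    least 3 in the path of a common neighbour.

    [M <= h] implies [G \in [h,2,1]] for [h >= 3]: contract every tree edge whose
    end nodes carry comparable sets of paths; then each tree node [q] carries a
    clique.  Join two neighbours [i], [j] of [q] when some path uses both.  If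
    neither of the sets of paths through [q, i] and [q, j] contains the other,
    this edge comes from an edge of the branch graph at [q]; otherwise [i] or
    [j] is pendant, because a path through [q] uses at most two neighbours.
    Hence the graph on the neighbours of [q] is [h]-colourable.  While [q] has
    degree more than [h], two neighbours have the same colour, and they can be
    moved to a new node of degree 3 attached to [q]. *)

(** * Trees *)

Lemma connect_cross (U : finType) (r : rel U) (S : {set U}) x y :
  connect r x y -> x \in S -> y \notin S ->
  exists c d, [/\ c \in S, d \notin S & r c d].
Proof.
case/connectP => p; elim: p x => [|z p IHp] x /= => [_ -> ->//|].
case/andP=> rxz pzp yE xS yS; case: (boolP (z \in S)) => zS.
  exact: IHp pzp yE zS yS.
by exists x, z.
Qed.

Lemma connect_homo (U V : finType) (r : rel U) (s : rel V) (g : U -> V) :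
  (forall a b, r a b -> connect s (g a) (g b)) ->
  forall x y, connect r x y -> connect s (g x) (g y).
Proof.
move=> rs x y /connectP [p]; elim: p x => [|z p IHp] x /= => [_ -> //|].
by case/andP=> rxz pzp yE; apply: connect_trans (rs _ _ rxz) (IHp _ pzp yE).
Qed.

Definition cut (U : finType) (f : rel U) (a b : U) (S : {set U}) : Prop :=
  [/\ a \in S, b \notin S &
      forall c d, c \in S -> d \notin S -> f c d -> c = a /\ d = b].

(* Acyclicity: every edge is the only edge leaving some set of nodes.  Such cuts
   are easy to transport when nodes are merged or split. *)
Definition tree (U : finType) (f : rel U) : Prop :=
  [/\ symmetric f, irreflexive f, forall x y, connect f x y &
      forall a b, f a b -> exists S, cut f a b S].

Definition conn (U : finType) (f : rel U) (A : {set U}) : bool :=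
  [forall x in A, forall y in A, connect (rel_in f A) x y].

Lemma connP (U : finType) (f : rel U) (A : {set U}) :
  reflect (forall x y, x \in A -> y \in A -> connect (rel_in f A) x y)
          (conn f A).
Proof.
apply: (iffP forall_inP) => [H x y xA yA | H x xA].
  by move/forall_inP: (H x xA); apply.
by apply/forall_inP => y; apply: H.
Qed.

Lemma rel_inE (U : finType) (f : rel U) (A : {set U}) a b :
  rel_in f A a b = [&& a \in A, b \in A & f a b].
Proof. by []. Qed.

Lemma sym_rel_in (U : finType) (f : rel U) (A : {set U}) :
  symmetric f -> symmetric (rel_in f A).
Proof. by move=> fS x y; rewrite !rel_inE fS andbCA. Qed.

Lemma cutC (U : finType) (f : rel U) a b S :
  symmetric f -> cut f a b S -> cut f b a (~: S).
Proof.
move=> fS [aS bS H]; split; rewrite ?inE ?aS //.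
move=> c d; rewrite !inE negbK => cS dS; rewrite fS => fdc.
by case: (H _ _ dS cS fdc) => -> ->.
Qed.

(** If [a] lies outside [B], reflexivity of [connect] makes this [{a}]; hence the hypotheses
    [a \in B] below. *)
Definition comp (U : finType) (f : rel U) (B : {set U}) (a : U) : {set U} :=
  [set u | connect (rel_in f B) a u].

(** For a neighbour [a] of [m] in a tree: the branch at [m] that starts with [a]. *)
Definition side (U : finType) (f : rel U) (m a : U) : {set U} :=
  comp f (~: [set m]) a.

Lemma comp_sub (U : finType) (f : rel U) (B : {set U}) a u :
  a \in B -> u \in comp f B a -> u \in B.
Proof.
rewrite inE => aB /connect_cross H; apply/negPn/negP => uB.
by case: (H B aB uB) => c [d] [_ dB /and3P [_]]; rewrite (negPf dB).
Qed.

Lemma mem_comp (U : finType) (f : rel U) (B : {set U}) a : a \in comp f B a.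
Proof. by rewrite inE connect0. Qed.

Lemma comp_step (U : finType) (f : rel U) (B : {set U}) a c d :
  a \in B -> c \in comp f B a -> f c d -> d \in B -> d \in comp f B a.
Proof.
move=> aB cc fcd dB; have cB := comp_sub aB cc; move: cc; rewrite !inE => cc.
by apply: connect_trans cc (connect1 _); rewrite rel_inE cB dB.
Qed.

(** The nodes reachable from [a] inside the component form a set that no edge within [B] can
    leave. *)
Lemma conn_comp (U : finType) (f : rel U) (B : {set U}) a :
  symmetric f -> a \in B -> conn f (comp f B a).
Proof.
move=> fS aB; set Q := comp f B a.
have H u : u \in Q -> connect (rel_in f Q) a u.
  move=> uQ; apply/negPn/negP => nau.
  move: (uQ); rewrite /Q inE => cau.
  have aR : a \in [set w | connect (rel_in f Q) a w] by rewrite inE connect0.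
  have uR : u \notin [set w | connect (rel_in f Q) a w] by rewrite inE.
  case: (connect_cross cau aR uR) => c [d] []; rewrite !inE => cR /negP dR.
  case/and3P=> cB dB fcd; have cQ : c \in Q.
    rewrite inE; apply: connect_sub cR => x y /and3P [xQ yQ fxy].
    by apply: connect1; rewrite rel_inE fxy (comp_sub aB xQ) (comp_sub aB yQ).
  apply: dR; apply: connect_trans cR (connect1 _).
  by rewrite rel_inE cQ fcd (comp_step aB cQ fcd dB).
apply/connP => x y xQ yQ; apply: connect_trans (H y yQ).
by rewrite (sym_connect_sym (sym_rel_in _ fS)) H.
Qed.

Section Tree.
Variables (U : finType) (f : rel U).
Hypothesis fT : tree f.

Let fS : symmetric f. Proof. by case: fT. Qed.
Let fI : irreflexive f. Proof. by case: fT. Qed.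
Let fC : forall x y, connect f x y. Proof. by case: fT. Qed.

Lemma adj_neq a b : f a b -> a != b.
Proof. by apply: contraTneq => ->; rewrite fI. Qed.

Lemma side_notin m a : f m a -> m \notin side f m a.
Proof.
move=> fma; have am : a \in ~: [set m] by rewrite !inE eq_sym adj_neq.
by apply/negP => /(comp_sub am); rewrite !inE eqxx.
Qed.

Lemma conn_side m a : f m a -> conn f (side f m a).
Proof. by move=> fma; apply: conn_comp => //; rewrite !inE eq_sym adj_neq. Qed.

(** A walk avoiding [m] cannot leave the cut of the edge [a m], so [b] lies in it as well; the edge
    [b m] leaves it and must be [a m]. *)
Lemma side_inj m a b : f m a -> f m b -> b \in side f m a -> a = b.
Proof.
move=> fma fmb; case: fT => _ _ _ /(_ a m); rewrite fS => /(_ fma) [S [aS mS H]].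
rewrite inE => cab; have bS : b \in S.
  apply/negPn/negP => bS; case: (connect_cross cab aS bS) => c [d] [cS dS].
  case/and3P=> _ dm fcd; case: (H _ _ cS dS fcd) => _ dE.
  by rewrite dE !inE eqxx in dm.
by rewrite fS in fmb; case: (H _ _ bS mS fmb).
Qed.

(** A walk in [A] from [u] to [m] leaves the side only by stepping onto [m], and by [side_inj] it
    does so from [a]. *)
Lemma side_cross m a A u :
  f m a -> conn f A -> m \in A -> u \in A -> u \in side f m a -> a \in A.
Proof.
move=> fma /connP cA mA uA us; have am := adj_neq fma.
have aB : a \in ~: [set m] by rewrite !inE eq_sym.
case: (connect_cross (cA _ _ uA mA) us (side_notin fma)) => c [d] [cs ds].
case/and3P=> cA' dA fcd; have dm : d = m.
  apply/eqP/negPn/negP => dm; case/negP: ds.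
  by apply: (comp_step aB cs fcd); rewrite !inE.
by rewrite dm fS in fcd; rewrite (side_inj fma fcd cs).
Qed.

Lemma conn_sub_side m a A u :
  conn f A -> m \notin A -> u \in A -> u \in side f m a -> A \subset side f m a.
Proof.
move=> /connP cA mA uA us; apply/subsetP => w wA; move: us; rewrite !inE => us.
apply: connect_trans us _; apply: connect_sub (cA _ _ uA wA) => x y.
case/and3P=> xA yA fxy; apply: connect1; rewrite rel_inE fxy !inE.
by rewrite (memPn mA _ xA) (memPn mA _ yA).
Qed.

Lemma exists_side m u : u != m -> exists a, f m a /\ u \in side f m a.
Proof.
move=> um; have uB : u \in ~: [set m] by rewrite !inE.
have mQ : m \notin comp f (~: [set m]) u.
  by apply/negP => /(comp_sub uB); rewrite !inE eqxx.
case: (connect_cross (fC u m) (mem_comp _ _ _) mQ) => c [d] [cQ dQ fcd].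
have dm : d = m.
  apply/eqP/negPn/negP => dm; case/negP: dQ.
  by apply: (comp_step uB cQ fcd); rewrite !inE.
exists c; rewrite fS -dm fcd; split=> //; rewrite dm.
by move: cQ; rewrite !inE (sym_connect_sym (sym_rel_in _ fS)).
Qed.

(** Walk along a simple path of [A]: [B] contains both ends, so [side_cross] puts each next node
    into [B]. *)
Lemma conn_setI A B : conn f A -> conn f B -> conn f (A :&: B).
Proof.
move=> /connP cA cB; apply/connP => x y /setIP [xA xB] /setIP [yA yB].
case/connectP: (cA x y xA yA) => p0 p0P; case/shortenP: p0P => p pP Up _ yE.
elim: p x xA xB pP Up yE {p0} => [|a p IHp] x xA xB /=; first by move=> _ _ ->.
case/andP=> /and3P [_ aA fxa] pP /andP [xp Up] yE.
have ys : y \in side f x a.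
  rewrite inE; apply/connectP; exists p => //.
  elim: p a pP xp {Up yE IHp aA fxa} => //= b p IHp a /andP [/and3P [_ bA fab] pP].
  rewrite !inE !negb_or => /and3P [xa xb xp].
  by rewrite rel_inE fab !inE eq_sym xa eq_sym xb /= IHp // inE negb_or xb.
have aB := side_cross fxa cB xB yB ys.
apply: connect_trans (IHp a aA aB pP Up yE); apply: connect1.
by rewrite rel_inE !inE xA xB aA aB.
Qed.

(** [t] is the node of [P] nearest to [z]. A connected set through [z] that avoids [t] stays on one
    side of [t], which [P] cannot meet without containing the neighbour [b] of [t] there. *)
Lemma gate P z : conn f P -> P != set0 -> exists2 t, t \in P &
  forall A u, conn f A -> z \in A -> u \in A -> u \in P -> t \in A.
Proof.
move=> cP /set0Pn [u0 u0P]; case: (boolP (z \in P)) => zP; first by exists z.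
have zB : z \in ~: P by rewrite inE.
have u0Q : u0 \notin comp f (~: P) z.
  by apply/negP => /(comp_sub zB); rewrite inE u0P.
case: (connect_cross (fC z u0) (mem_comp _ _ _) u0Q) => b [t] [bQ tQ fbt].
have tP : t \in P.
  apply/negPn/negP => tP; case/negP: tQ.
  by apply: (comp_step zB bQ fbt); rewrite inE.
exists t => // A u cA zA uA uP; apply/negPn/negP => tA.
have ftb : f t b by rewrite fS.
have bP := comp_sub zB bQ.
have QP : t \notin comp f (~: P) z by apply/negP=> /(comp_sub zB); rewrite inE tP.
have /subsetP Qs := conn_sub_side (conn_comp fS zB) QP bQ (mem_comp _ _ _).
have zs := Qs _ (mem_comp _ _ _).
have /subsetP As := conn_sub_side cA tA zA zs.
move: bP; rewrite inE => /negP; apply.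
exact: side_cross ftb cP tP uP (As _ uA).
Qed.

Lemma median x y z : exists m,
  [/\ forall A, conn f A -> x \in A -> y \in A -> m \in A,
      forall A, conn f A -> x \in A -> z \in A -> m \in A &
      forall A, conn f A -> y \in A -> z \in A -> m \in A].
Proof.
(* The path from [x] to [y]; its gate from [z] is the median. *)
pose I := \bigcap_(A : {set U} | [&& conn f A, x \in A & y \in A]) A.
have cI : conn f I.
  apply: (big_ind (fun A => conn f A)); [|exact: conn_setI|by move=> A /and3P[]].
  apply/connP => u v _ _; apply: connect_sub (fC u v) => a b fab.
  by apply: connect1; rewrite rel_inE !inE.
have xI : x \in I by apply/bigcapP => A /and3P[].
have yI : y \in I by apply/bigcapP => A /and3P[].
have I0 : I != set0 by apply/set0Pn; exists x.
case: (gate z cI I0) => m mI H; exists m; split=> A cA.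
- by move=> xA yA; move/bigcapP: mI; apply; rewrite cA xA.
- by move=> xA zA; apply: H cA zA xA xI.
- by move=> yA zA; apply: H cA zA yA yI.
Qed.

End Tree.

(** The cut of the edge [a b] is the component of [a] without [b]: a second edge from it to [b]
    would close a cycle. *)
Lemma is_tree_tree n (f : rel 'I_n) : is_tree f -> tree f.
Proof.
case=> fS fI _ fC nc; split=> // a b fab.
have ab : a != b by apply: contraTneq fab => ->; rewrite fI.
have aB : a \in ~: [set b] by rewrite !inE.
exists (comp f (~: [set b]) a); split; first exact: mem_comp.
  by apply/negP => /(comp_sub aB); rewrite !inE eqxx.
move=> c d cQ dQ fcd; have db : d = b.
  apply/eqP/negPn/negP => db; case/negP: dQ.
  by apply: (comp_step aB cQ fcd); rewrite !inE.
split=> //; rewrite {dQ}db in fcd.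
apply/eqP/negPn/negP => nca; apply: nc.
move: cQ; rewrite inE => /connectP [p0 p0P]; case/shortenP: p0P => p pP Up _ cE.
exists (b :: a :: p); split.
  by case: p {pP Up} cE => //= ca; rewrite ca eqxx in nca.
have bp : (path f a p) && (b \notin a :: p).
  rewrite inE negb_or eq_sym ab /=.
  elim: p a pP {Up cE aB ab fab nca p0} => //= u p IHp a.
  case/andP=> /and3P [_ ub fau] /IHp /andP [pu bp].
  by rewrite fau pu /= inE negb_or bp andbT eq_sym; rewrite !inE in ub.
case/andP: bp => pa bp.
by rewrite /ucycle /= bp rcons_path fS fab pa -cE fcd.
Qed.

(** On a cycle [x y z ...] take the cut of [x y]: the walk from [y] cannot re-enter it before [x],
    so the closing edge crosses it too, from a node other than [y]. *)
Lemma tree_acyclic (U : finType) (f : rel U) :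
  tree f -> ~ (exists c : seq U, 3 <= size c /\ ucycle f c).
Proof.
case=> fS fI _ fcut [[|x [|y [|z p]]]] [] // _ /andP [].
rewrite [cycle _ _]/= => /andP [fxy]; rewrite -[_ && _]/(path f y (rcons (z :: p) x)).
rewrite rcons_path => /andP [pP lx].
rewrite [uniq _]/= -/(uniq (y :: z :: p)) => /andP [xp Up].
case: (fcut x y fxy) => S [xS yS H].
have allS (q : seq U) u : u \notin S -> path f u q -> x \notin q -> last u q \notin S.
  elim: q u => //= w q IHq u uS /andP [fuw pq]; rewrite inE negb_or => /andP [xw xq].
  apply: IHq => //; apply/negP => wS; rewrite fS in fuw.
  by case: (H _ _ wS uS fuw) => wx; rewrite wx eqxx in xw.
have lS := allS _ _ yS pP _; rewrite fS in lx.
have xzp : x \notin z :: p by move: xp; rewrite inE negb_or => /andP [].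
case: (H _ _ xS (lS xzp) lx) => _ ly.
move: Up => /= /andP [/negP + _]; apply; rewrite -{1}ly /=; exact: mem_last.
Qed.

(** * Representations of bounded degree bound the branch graphs *)

Lemma colorable_in (T U : finType) (A : {set T}) (r : rel T) (N : {set U}) h
    (c : T -> U) :
  0 < h -> #|N| <= h -> {in A, forall x, c x \in N} ->
  {in A &, forall x y, x != y -> r x y -> c x != c y} -> colorable A r h.
Proof.
case: h => // h _ Nh cN cP; apply/existsP.
exists [ffun x => inord (index (c x) (enum N))].
apply/forall_inP => x xA; apply/forall_inP => y yA; apply/implyP => /andP [xy rxy].
have lt z : z \in A -> index (c z) (enum N) < h.+1.
  by move=> zA; apply: leq_trans Nh; rewrite cardE index_mem mem_enum cN.
rewrite !ffunE -val_eqE /= !inordK ?lt //; apply: contra (cP _ _ xA yA xy rxy).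
move/eqP=> ixy; apply/eqP.
by apply: (index_inj (c x) (s := enum N)); rewrite ?mem_enum ?cN // ixy.
Qed.

Lemma colorable_fun (T : finType) (A : {set T}) (r : rel T) h :
  colorable A r h -> exists c : T -> 'I_h,
    {in A &, forall x y, x != y -> r x y -> c x != c y}.
Proof.
case/existsP=> c /forall_inP cP; exists c => x y xA yA xy rxy.
by move/forall_inP: (cP x xA) => /(_ y yA); rewrite xy rxy.
Qed.

Lemma colorable_leq (T : finType) (A : {set T}) (r : rel T) h k :
  h <= k -> colorable A r h -> colorable A r k.
Proof.
move=> hk /colorable_fun [c cP]; apply/existsP.
exists [ffun x => widen_ord hk (c x)].
apply/forall_inP => x xA; apply/forall_inP => y yA; apply/implyP => /andP [xy rxy].
by rewrite !ffunE -val_eqE; apply: cP.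
Qed.

Lemma chi_leq (T : finType) (A : {set T}) (r : rel T) h :
  (chi A r <= h) = colorable A r h.
Proof.
rewrite /chi; case: ex_minnP => k kP kmin.
by apply/idP/idP => [/colorable_leq|/kmin //]; apply.
Qed.

(** The type of nodes is arbitrary, since nodes are merged and added below. The degree of the tree
    is left free, and degree at most 2 inside [P v] reads: no three distinct neighbours. *)
Definition rep (T : finType) (e : rel T) (U : finType) (f : rel U)
    (P : T -> {set U}) : Prop :=
  [/\ tree f, forall v, conn f (P v), forall v, P v != set0,
      forall v x a b c, [/\ x \in P v, a \in P v, b \in P v & c \in P v] ->
        [/\ f x a, f x b & f x c] -> ~ [/\ a != b, b != c & c != a] &
      forall v w, v != w -> (e v w <-> exists2 u, u \in P v & u \in P w)].

Lemma has_rep_rep (T : finType) (e : rel T) h : has_rep e h 2 1 ->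
  exists (U : finType) (f : rel U) (P : T -> {set U}),
    rep e f P /\ if h is Some k then forall x, #|[set y | f x y]| <= k else True.
Proof.
case=> n [f] [P] [/is_tree_tree fT fh Psub Pdeg Padj].
exists 'I_n, f, P; split=> //; split=> //.
- by move=> v; apply/connP; case: (Psub v).
- by move=> v; case: (Psub v).
- move=> v x a b c [xP aP bP cP] [fa fb fc] [ab bc ca].
  have := Pdeg v x xP; rewrite leqNgt => /negP; apply.
  by apply/card_gt2P; exists a, b, c; rewrite !inE aP bP cP fa fb fc.
- move=> v w /Padj; rewrite card_gt0 => -[H1 H2]; split.
    by case/H1/set0Pn => u /setIP [uv uw]; exists u.
  by case=> u uv uw; apply/H2/set0Pn; exists u; rewrite inE uv.
Qed.

Lemma completeP (T : finType) (e : rel T) (C : {set T}) :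
  reflect {in C &, forall x y, x != y -> e x y} (complete e C).
Proof.
apply: (iffP forall_inP) => [H x y xC yC xy | H x xC].
  by move/forall_inP: (H x xC) => /(_ y yC); rewrite xy.
by apply/forall_inP => y yC; apply/implyP; apply: H.
Qed.

Section Rep.
Variables (T : finType) (e : rel T) (U : finType) (f : rel U).
Variable P : T -> {set U}.
Hypothesis eP : rep e f P.

Let fT : tree f. Proof. by case: eP. Qed.
Let cP v : conn f (P v). Proof. by case: eP. Qed.
Let nP v : P v != set0. Proof. by case: eP. Qed.

Definition bag (q : U) : {set T} := [set v | q \in P v].

Lemma complete_bag q : complete e (bag q).
Proof.
apply/completeP => x y; rewrite !inE => xq yq xy.
by case: eP => _ _ _ _ /(_ x y xy) [_]; apply; exists q.
Qed.

(** Take a node on as many paths of [C] as possible. If the path of [d] misses it, the gate of [P d]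
    is on all those paths and on [P d], one more. *)
Lemma helly C : 0 < #|T| -> complete e C -> exists q, C \subset bag q.
Proof.
case/card_gt0P => v0 _; case/set0Pn: (nP v0) => u0 _ /completeP cC.
case: (arg_maxnP (fun q => #|bag q :&: C|) (isT : xpredT u0)) => q _ qmax.
exists q; apply/subsetP => d dC; rewrite inE; apply/negPn/negP => qd.
case: (gate fT q (cP d) (nP d)) => t td tP.
have : #|bag t :&: C| <= #|bag q :&: C| by apply: qmax.
rewrite leqNgt => /negP; apply; apply: proper_card.
apply/properP; split; last by exists d; rewrite !inE ?dC ?td // (negPf qd).
apply/subsetP => v /setIP []; rewrite !inE => qv vC; rewrite vC andbT.
case: (eqVneq v d) => [-> // | vd].
case: eP => _ _ _ _ /(_ v d vd) [/(_ (cC _ _ vC dC vd)) [u uv ud] _].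
exact: tP (cP v) qv uv ud.
Qed.

Lemma clique_bag C : 0 < #|T| -> is_clique e C -> exists q, C = bag q.
Proof.
move=> T0 /andP [cC /forallP maxC]; case: (helly T0 cC) => q Cq; exists q.
apply/eqP; rewrite eqEproper Cq; apply/negP => /(implyP (maxC _)).
by rewrite complete_bag.
Qed.

Lemma branch_colorable h C : 0 < #|T| -> 0 < h ->
  (forall x, #|[set y | f x y]| <= h) -> is_clique e C ->
  colorable (Bset e C) (Brel e C) h.
Proof.
move=> T0 h0 fh Ccl; case: (clique_bag T0 Ccl) => q ->.
case: eP => _ _ _ degP adjP.
pose g v := odflt q [pick a | f q a && (P v \subset side f q a)].
have gP v : v \in Bset e (bag q) -> f q (g v) && (P v \subset side f q (g v)).
  rewrite !inE => /andP [qv _]; rewrite /g; case: pickP => //= H.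
  case/set0Pn: (nP v) => u uv; have uq : u != q by apply: contraNneq qv => <-.
  case: (exists_side fT uq) => a [fqa ua].
  by have := H a; rewrite fqa (conn_sub_side (cP v) qv uv ua).
apply: (colorable_in (N := [set y | f q y]) (c := g)) => // [v /gP|v w vA wA vw].
  by rewrite inE => /andP [].
have [/andP [fqa va] /andP [_ wa]] := (gP _ vA, gP _ wA).
case/and5P=> _ nvw /exists_inP [c cq /andP [ecv ecw]].
case/exists_inP => v' v'q /andP [ev'v nev'w].
case/exists_inP => w' w'q /andP [ew'w new'v].
apply/eqP => gvw; rewrite -gvw in wa.
have meet x y : x \in bag q -> y \in Bset e (bag q) ->
    e x y <-> exists2 u, u \in P x & u \in P y.
  by move=> xq yA; apply: adjP; apply: contraTneq yA => <-; rewrite inE xq.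
(* [s] and [t] are the nodes of the two paths nearest to [q]. *)
case: (gate fT q (cP v) (nP v)) => s sv sP.
case: (gate fT q (cP w) (nP w)) => t tw tP.
have ins x : x \in bag q -> e x v -> s \in P x.
  move=> xq /(meet _ _ xq vA) [u ux uv].
  by apply: sP (cP x) _ ux uv; rewrite inE in xq.
have int x : x \in bag q -> e x w -> t \in P x.
  move=> xq /(meet _ _ xq wA) [u ux uw].
  by apply: tP (cP x) _ ux uw; rewrite inE in xq.
have qP x : x \in bag q -> q \in P x by rewrite inE.
case: (median fT q s t) => m [mqs mqt mst].
(* By [gvw] both paths lie in the same side of [q], a connected set avoiding [q]. *)
have mq : m != q.
  apply: contraTneq (side_notin fT fqa) => mq; rewrite negbK -{1}mq.
  exact: mst (conn_side fT fqa) (subsetP va _ sv) (subsetP wa _ tw).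
(* If [m = s], the path of [w'], which contains [q] and [t], would meet [P v]. *)
have ms : m != s.
  apply: contraNneq new'v => ms; apply/(meet _ _ w'q vA); exists s => //.
  by rewrite -ms; apply: mqt (cP _) (qP _ w'q) (int _ w'q ew'w).
have mt : m != t.
  apply: contraNneq nev'w => mt; apply/(meet _ _ v'q wA); exists t => //.
  by rewrite -mt; apply: mqs (cP _) (qP _ v'q) (ins _ v'q ev'v).
have [[qc sc] tc] := (qP _ cq, ins _ cq ecv, int _ cq ecw).
have mc := mqs _ (cP c) qc sc.
have := @exists_side _ _ fT m; move=> sideP.
rewrite eq_sym in mq; rewrite eq_sym in ms; rewrite eq_sym in mt.
(* The neighbours of [m] towards [q], [s] and [t] all lie on [P c]. They are distinct, as a side of
   [m] cannot contain two nodes that [m] separates. *)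
have [a1 [f1 q1]] := sideP _ mq; have [a2 [f2 s2]] := sideP _ ms.
have [a3 [f3 t3]] := sideP _ mt.
apply: (degP c m a1 a2 a3) => //.
  by split=> //; [apply: side_cross f1 (cP c) mc qc q1
    | apply: side_cross f2 (cP c) mc sc s2 | apply: side_cross f3 (cP c) mc tc t3].
split; apply/eqP => aE.
- by case/negP: (side_notin fT f1); apply: mqs; rewrite ?(conn_side fT) // aE.
- by case/negP: (side_notin fT f2); apply: mst; rewrite ?(conn_side fT) // aE.
- by case/negP: (side_notin fT f1); apply: mqt; rewrite ?(conn_side fT) // -aE.
Qed.

End Rep.

(** * Contracting redundant nodes *)

Lemma conn_between (U : finType) (f : rel U) x a b A : tree f ->
  conn f A -> f x a -> f x b -> a != b -> a \in A -> b \in A -> x \in A.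
Proof.
move=> fT cA fxa fxb ab aA bA; apply/negPn/negP => xA.
have /subsetP As := conn_sub_side cA xA aA (mem_comp _ _ _).
by rewrite (side_inj fT fxa fxb (As _ bA)) eqxx in ab.
Qed.

Section Contract.
Variables (T : finType) (e : rel T) (U : finType) (f : rel U).
Variable P : T -> {set U}.
Hypothesis eP : rep e f P.
Variables q x : U.
Hypotheses (fqx : f q x) (xq : bag P x \subset bag P q).

Let fT : tree f. Proof. by case: eP. Qed.
Let cP v : conn f (P v). Proof. by case: eP. Qed.
Let fS : symmetric f. Proof. by case: fT. Qed.

Let fxq : f x q. Proof. by rewrite fS. Qed.

Let qx : q != x. Proof. exact: adj_neq fT _ _ fqx. Qed.

Let V : finType := {u : U | u != x}.
(** [insubd] falls back on its default [q] only at [x], so this merges [x] into [q]. *)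
Let pi (u : U) : V := insubd (Sub q qx : V) u.
Let fc : rel V := [rel a b | (a != b) &&
  [exists c, exists d, [&& pi c == a, pi d == b & f c d]]].
Let Pc v : {set V} := pi @: P v.

Let fcP a b : reflect (a != b /\ exists c d, [/\ pi c = a, pi d = b & f c d])
                      (fc a b).
Proof.
apply: (iffP andP) => -[ab H]; split=> //.
  by case/existsP: H => c /existsP [d] /and3P [/eqP <- /eqP <- fcd]; exists c, d.
by case: H => c [d] [<- <- fcd]; apply/existsP; exists c; apply/existsP; exists d;
  rewrite !eqxx.
Qed.

Let val_pi u : val (pi u) = if u != x then u else q.
Proof. by rewrite /pi val_insubd. Qed.

Let pi_val (a : V) : pi (val a) = a.
Proof. by apply: val_inj; rewrite val_pi (valP a). Qed.

Let pi_eq u a : pi u = a -> u = val a \/ u = x /\ val a = q.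
Proof.
by move=> <-; rewrite val_pi; case: (eqVneq u x) => [->|_]; [right|left].
Qed.

Let xP v : x \in P v -> q \in P v.
Proof. by move: (subsetP xq v); rewrite !inE. Qed.

(** Paths through [x] also pass through [q], so contraction merely deletes [x] from them. *)
Let PcP v a : (a \in Pc v) = (val a \in P v).
Proof.
apply/imsetP/idP => [[u uP /esym/pi_eq [<- //|[ux ->]]]|aP].
  by apply: xP; rewrite -ux.
by exists (val a); rewrite ?pi_val.
Qed.

Let tree_fc : tree fc.
Proof.
split.
- move=> a b; apply/fcP/fcP => -[ab [c [d [cE dE fcd]]]];
    by split; [rewrite eq_sym | exists d, c; rewrite fS].
- by move=> a; rewrite /fc /= eqxx.
- move=> a b; rewrite -(pi_val a) -(pi_val b).
  case: fT => _ _ /(_ (val a) (val b)) + _; apply: connect_homo => c d fcd.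
  case: (eqVneq (pi c) (pi d)) => [->|ncd]; first exact: connect0.
  by apply: connect1; apply/fcP; split=> //; exists c, d.
- move=> a b /fcP [ab [c [d [cE dE fcd]]]].
  case: fT => _ _ _ /(_ c d fcd) [S cS]; case: (cS) => cinS dS H.
  (* If [S] separated [q] from [x], the only edge crossing it would be the contracted one, but [c d]
     crosses it and is not contracted. *)
  have qxS : (q \in S) = (x \in S).
    apply/idP/idP => [qS|xS]; apply/negPn/negP => nS.
      case: (H _ _ qS nS fqx) => qc xd; case/eqP: ab; rewrite -cE -dE -qc -xd.
      by apply: val_inj; rewrite !val_pi qx eqxx.
    case: (H _ _ xS nS fxq) => xc qd; case/eqP: ab.
    rewrite -cE -dE -qd -xc.
    by apply: val_inj; rewrite !val_pi qx eqxx.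
  have piS u : (val (pi u) \in S) = (u \in S).
    by rewrite val_pi; case: eqVneq => //= ->.
  exists [set u | val u \in S]; split; rewrite ?inE -?cE -?dE ?piS //.
  move=> a' b'; rewrite !inE => a'S b'S /fcP [_ [c' [d' [c'E d'E fcd']]]].
  rewrite -c'E -d'E !piS in a'S b'S *.
  by case: (H _ _ a'S b'S fcd') => -> ->.
Qed.

(** An edge of the contracted tree comes from an edge of [f], possibly with [x] in place of [q]. In
    that case [x] lies between two nodes of the path, hence on it. *)
Let nbr v y a : fc y a -> y \in Pc v -> a \in Pc v ->
  [\/ f (val y) (val a), [/\ val y = q, f x (val a) & x \in P v]
   | [/\ val a = q, f (val y) x & x \in P v]].
Proof.
move=> /fcP [ya [c [d [cE dE fcd]]]]; rewrite !PcP => yP aP.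
have nya : val y != val a by rewrite val_eqE.
case: (pi_eq cE) (pi_eq dE) => [cy|[cx yq]] [da|[dx aq]].
- by constructor 1; rewrite -cy -da.
- rewrite cy dx in fcd; constructor 3; split=> //.
  rewrite aq in nya aP; have fxy : f x (val y) by rewrite fS.
  exact: (conn_between fT (cP v) fxy fxq nya yP aP).
- rewrite da cx in fcd; constructor 2; split=> //.
  rewrite yq in nya yP.
  exact: (conn_between fT (cP v) fxq fcd nya yP aP).
- by move: fcd; rewrite cx dx; case: fT => _ ->.
Qed.

Lemma contract_rep : exists (W : finType) (g : rel W) (Q : T -> {set W}),
  rep e g Q /\ #|W| < #|U|.
Proof.
exists V, fc, Pc; split; last first.
  rewrite card_sig (@eq_card _ _ (predC1 x)) // cardC1 prednK //.
  by apply/card_gt0P; exists x.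
case: (eP) => _ _ nP degP adjP; split=> //.
- move=> v; apply/connP => a b; rewrite !PcP => aP bP.
  rewrite -(pi_val a) -(pi_val b).
  move/connP: (cP v) => /(_ _ _ aP bP); apply: connect_homo => c d.
  case/and3P=> cPv dP fcd.
  case: (eqVneq (pi c) (pi d)) => [->|ncd]; first exact: connect0.
  apply: connect1; rewrite rel_inE !imset_f //=.
  by apply/fcP; split=> //; exists c, d.
- by move=> v; rewrite imset_eq0.
- move=> v y a b c [yP aP bP cPv] [ya yb yc] [ab bc ca].
  have := nbr ya yP aP; have := nbr yb yP bP; have := nbr yc yP cPv.
  move: yP aP bP cPv; rewrite !PcP; move: ab bc ca; rewrite -!val_eqE.
  move/fcP: ya => [+ _]; move/fcP: yb => [+ _]; move/fcP: yc => [+ _].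
  rewrite -!val_eqE; move: (valP a) (valP b) (valP c) => /=.
  set y0 := val y; set a0 := val a; set b0 := val b; set c0 := val c.
  move=> ax bx cx yc yb ya ab bc ca yP aP bP cPv.
  have D s t u w : s \in P v -> t \in P v -> u \in P v -> w \in P v ->
    f s t -> f s u -> f s w -> t != u -> u != w -> w != t -> False.
    by move=> *; apply: (degP v s t u w).
  (* At the merged node each of the three is a neighbour of [q] or of [x]. If just one belongs to
     [x], replace it by [x] and argue at [q]; if two do, take them with [q] and argue at [x]. *)
  case: (eqVneq y0 q) => [yq|yq].
    have alt z : y0 != z -> [\/ f y0 z, [/\ y0 = q, f x z & x \in P v]
        | [/\ z = q, f y0 x & x \in P v]] ->
        f q z \/ f x z /\ x \in P v.
      move=> yz [fz|[_ fz xv]|[zq _ _]]; [by left; rewrite -yq|by right|].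
      by rewrite zq yq eqxx in yz.
    move=> /(alt _ yc) {}yc' /(alt _ yb) {}yb' /(alt _ ya) {}ya'.
    rewrite {}yq in ya yb yc yP.
    have [qa qb qc] : [/\ a0 != q, b0 != q & c0 != q].
      by rewrite eq_sym ya eq_sym yb eq_sym yc.
    have [xa xb] : x != a0 /\ x != b0 by rewrite !(eq_sym x).
    have xc : x != c0 by rewrite eq_sym.
    case: ya' => [fa|[fa xv]]; case: yb' => [fb|[fb xv']];
      case: yc' => [fc'|[fc' xv'']].
    + exact: (D q a0 b0 c0).
    + by apply: (D q a0 b0 x) => //; rewrite eq_sym.
    + by apply: (D q a0 x c0) => //; rewrite eq_sym.
    + by apply: (D x b0 c0 q).
    + by apply: (D q x b0 c0).
    + by apply: (D x a0 q c0) => //; rewrite eq_sym.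
    + by apply: (D x a0 b0 q).
    + by apply: (D x a0 b0 c0).
  have alt z : y0 != z -> z \in P v -> z != x ->
      [\/ f y0 z, [/\ y0 = q, f x z & x \in P v]
        | [/\ z = q, f y0 x & x \in P v]] ->
      exists z', [/\ f y0 z', z' \in P v & z' = z \/ z' = x /\ z = q].
    move=> yz zP zx [fz|[yq' _ _]|[zq fz xv]].
    + by exists z; split=> //; left.
    + by rewrite yq' eqxx in yq.
    + by exists x; split=> //; right.
  case/(alt _ yc cPv cx) => c1 [fc1 cP1 cE].
  case/(alt _ yb bP bx) => b1 [fb1 bP1 bE].
  case/(alt _ ya aP ax) => a1 [fa1 aP1 aE].
  have neq z z' w w' : z != z' -> z != x -> z' != x ->
      w = z \/ w = x /\ z = q -> w' = z' \/ w' = x /\ z' = q -> w != w'.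
    move=> zz zx z'x [->|[-> zq]] [->|[-> z'q]] //; first by rewrite eq_sym.
    by rewrite zq z'q eqxx in zz.
  apply: (D y0 a1 b1 c1) => //.
  + exact: neq ab ax bx aE bE.
  + exact: neq bc bx cx bE cE.
  + exact: neq ca cx ax cE aE.
- move=> v w /adjP [H1 H2]; split.
    by case/H1 => u uv uw; exists (pi u); apply: imset_f.
  by case=> u; rewrite !PcP => uv uw; apply: H2; exists (val u).
Qed.

End Contract.

Lemma reduced_rep (T : finType) (e : rel T) (U : finType) (f : rel U)
    (P : T -> {set U}) : rep e f P ->
  exists (W : finType) (g : rel W) (Q : T -> {set W}),
    rep e g Q /\ forall q x, g q x -> ~~ (bag Q x \subset bag Q q).
Proof.
have [n] := ubnP #|U|; elim: n U f P => // n IHn U f P Un eP.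
case: (boolP [exists q, exists x, f q x && (bag P x \subset bag P q)]).
  case/existsP=> q /existsP [x] /andP [fqx xq].
  case: (contract_rep eP fqx xq) => W [g] [Q] [eQ WU].
  by apply: IHn eQ; apply: leq_trans WU _.
rewrite negb_exists => /forallP H; exists U, f, P; split=> // q x fqx.
by move: (H q); rewrite negb_exists => /forallP /(_ x); rewrite fqx.
Qed.

(** * Colouring the neighbours of a node *)

(** If [bag P q] could be extended by [d], all paths through [q] would reach the gate of [P d],
    hence use the neighbour [a] of [q] towards it; then [bag P q] would lie in [bag P a]. *)
Lemma reduced_clique (T : finType) (e : rel T) (U : finType) (f : rel U)
    (P : T -> {set U}) : rep e f P ->
  (forall q x, f q x -> ~~ (bag P x \subset bag P q)) ->
  forall q, is_clique e (bag P q).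
Proof.
move=> eP red q; rewrite /is_clique (complete_bag eP); apply/forallP => D.
apply/implyP => /properP [qD [d dD dq]]; apply/negP => /completeP cD.
case: (eP) => fT cP nP _ adjP; rewrite inE in dq.
case: (gate fT q (cP d) (nP d)) => t td tP.
have tq : t != q by apply: contraNneq dq => <-.
case: (exists_side fT tq) => a [fqa ta].
have faq : f a q by case: fT => -> .
case/negP: (red _ _ faq); apply/subsetP => v vq.
have qv : q \in P v by rewrite inE in vq.
have vd : v != d by apply: contraNneq dq => <-.
case: (adjP v d vd) => /(_ (cD _ _ (subsetP qD _ vq) dD vd)) [u uv ud] _.
by rewrite inE; apply: side_cross fT _ _ _ _ fqa (cP v) qv (tP _ _ (cP v) qv uv ud) ta.
Qed.

(* Recolour one end of each monochromatic edge: that end is pendant, so nothing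
   else is disturbed; the rank decides when both ends are pendant. *)
Lemma flip_coloring (U : finType) (H : rel U) h (k0 : U -> 'I_h) :
  1 < h -> symmetric H -> irreflexive H ->
  (forall i j, H i j -> [\/ k0 i != k0 j, forall k, H i k -> k = j
                         | forall k, H j k -> k = i]) ->
  exists k : U -> 'I_h, forall i j, H i j -> k i != k j.
Proof.
move=> h1 HS HI HP; have h0 := ltnW h1.
pose alt (c : 'I_h) := if c == Ordinal h0 then Ordinal h1 else Ordinal h0.
have altP c : alt c != c by rewrite /alt; case: (eqVneq c) => [->|]; rewrite // eq_sym.
pose bad i j := [&& H i j, k0 i == k0 j & [forall k, H i k ==> (k == j)]].
pose flip i := [exists j, bad i j &&
                  (~~ bad j i || (enum_rank i < enum_rank j))].
exists (fun i => if flip i then alt (k0 i) else k0 i) => i j Hij.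
have badU a b c : bad a b -> H a c -> c = b.
  by case/and3P=> _ _ /forallP /(_ c) /implyP ab /ab /eqP.
have flipE a b : H a b -> flip a =
    bad a b && (~~ bad b a || (enum_rank a < enum_rank b)).
  move=> Hab; apply/existsP/idP => [[c]|ab]; last by exists b.
  by case/andP=> ac; rewrite (badU _ _ _ ac Hab) ac.
have Hji : H j i by rewrite HS.
have badE a b : H a b -> (forall k, H a k -> k = b) -> k0 a = k0 b -> bad a b.
  move=> Hab Ha kab; apply/and3P; split; rewrite ?kab //.
  by apply/forallP => k; apply/implyP => /Ha ->.
rewrite (flipE _ _ Hij) (flipE _ _ Hji).
(* A flipped node has a single edge, a monochromatic one; so a properly coloured edge keeps both its
   colours. *)
case: (eqVneq (k0 i) (k0 j)) => [kij|kij]; last first.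
  have [-> ->] : bad i j = false /\ bad j i = false.
    by rewrite /bad (eq_sym (k0 j)) (negPf kij) !andbF.
  by [].
have rij : (enum_rank i < enum_rank j) = ~~ (enum_rank j < enum_rank i).
  rewrite -leqNgt ltn_neqAle andbC; case: leqP => //= _; apply: contraTneq Hij.
  by move/val_inj/enum_rank_inj => ->; rewrite HI.
have [bij|bji] : bad i j \/ bad j i.
  case: (HP _ _ Hij); first by rewrite kij eqxx.
    by move=> Hi; left; apply: badE.
  by move=> Hj; right; apply: badE.
  rewrite bij rij; case: (bad j i); case: (_ < _); rewrite /= kij ?altP //.
  by rewrite eq_sym altP.
rewrite bji rij; case: (bad i j); case: (_ < _); rewrite /= kij ?altP //;
  by rewrite eq_sym altP.
Qed.

Definition loc (T U : finType) (f : rel U) (P : T -> {set U}) (q : U) : rel U :=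
  [rel i j | [&& f q i, f q j, i != j &
                 [exists v, [&& q \in P v, i \in P v & j \in P v]]]].

(** The invariant of the splitting phase: reducedness is lost there, since the bag of the new node
    lies inside that of [q]. *)
Definition loc_colorable (T U : finType) (f : rel U) (P : T -> {set U}) h :=
  forall q, exists k : U -> 'I_h, forall i j, loc f P q i j -> k i != k j.

Lemma locP (T U : finType) (f : rel U) (P : T -> {set U}) q i j :
  reflect ([/\ f q i, f q j & i != j] /\
           exists v, [/\ q \in P v, i \in P v & j \in P v])
          (loc f P q i j).
Proof.
apply: (iffP and4P) => [[qi qj ij /existsP [v /and3P vP]]|[[qi qj ij] [v vP]]].
  by split=> //; exists v.
by split=> //; apply/existsP; exists v; apply/and3P.
Qed.

Lemma reduced_loc_colorable (T : finType) (e : rel T) (U : finType) (f : rel U)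
    (P : T -> {set U}) h : 1 < h -> rep e f P ->
  (forall q x, f q x -> ~~ (bag P x \subset bag P q)) ->
  (forall C, is_clique e C -> colorable (Bset e C) (Brel e C) h) ->
  loc_colorable f P h.
Proof.
move=> h1 eP red hC q; have := hC _ (reduced_clique eP red q).
case/colorable_fun=> col colP; case: (eP) => fT cP nP degP adjP.
(* The branch-graph colour of some vertex whose path uses [i] but not [q]. Reducedness provides one
   for each neighbour [i] of [q], so the default colour is irrelevant there. *)
pose k0 i := if [pick v | (v \in bag P i) && (v \notin bag P q)] is Some v
             then col v else Ordinal (ltnW h1).
have k0P i : f q i -> exists v, [/\ i \in P v, q \notin P v & k0 i = col v].
  move=> fqi; rewrite /k0; case: pickP => [v|H]; first by rewrite !inE => /andP []; exists v.
  have /subsetPn [v vi vq] := red _ _ fqi.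
  by have := H v; rewrite vi vq.
apply: (flip_coloring (k0 := k0) h1).
- move=> i j; apply/locP/locP => -[[qi qj ij] [v [qv iv jv]]];
    by rewrite eq_sym ij; split=> //; exists v.
- by move=> i; apply/locP => -[[_ _]]; rewrite eqxx.
(* A further [k] would yield a path through [q], [i], [k] and hence [j], with three neighbours of
   [q]. *)
have pend i j : loc f P q i j -> bag P q :&: bag P i \subset bag P j ->
    forall k, loc f P q i k -> k = j.
  case/locP=> -[qi qj ij] _ /subsetP sub k /locP [[_ qk ik] [w [qw iw kw]]].
  have jw : j \in P w by have := sub w; rewrite !inE qw iw; apply.
  apply/eqP/negPn/negP => kj; apply: (degP w q i j k) => //.
  by rewrite ij eq_sym kj eq_sym ik.
move=> i j lij; have lji : loc f P q j i.
  case/locP: lij => -[qi qj ij] [v [qv iv jv]].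
  by apply/locP; rewrite eq_sym; split=> //; exists v.
case: (boolP (bag P q :&: bag P i \subset bag P j)) => [|/subsetPn [a]].
  by move=> /(pend _ _ lij); constructor 2.
case: (boolP (bag P q :&: bag P j \subset bag P i)) => [|/subsetPn [b]].
  by move=> /(pend _ _ lji); constructor 3.
(* [a] and [b] will serve as [v'] and [w'] in the branch graph, and [c], obtained next, as the
   common neighbour. *)
rewrite !inE => /andP [qb jb] ib /andP [qa ia] ja; constructor 1.
case/locP: lij => -[qi qj ij] [c [qc ic jc]].
case: (k0P i qi) => v [iv qv ->]; case: (k0P j qj) => w [jw qw ->].
have meet x y : q \in P x -> q \notin P y ->
    e x y <-> exists2 u, u \in P x & u \in P y.
  by move=> qx qy; apply: adjP; apply: contraNneq qy => <-.
have sub s y : f q s -> s \in P y -> q \notin P y -> P y \subset side f q s.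
  by move=> qs sy qy; apply: conn_sub_side (cP y) qy sy (mem_comp _ _ _).
have Pv := sub _ _ qi iv qv; have Pw := sub _ _ qj jw qw.
have nmeet s x y : f q s -> q \in P x -> s \notin P x -> q \notin P y ->
    P y \subset side f q s -> ~~ e x y.
  move=> qs qx sx qy Py; apply/negP => /(meet _ _ qx qy) [u ux uy].
  by case/negP: sx; apply: side_cross fT _ _ _ _ qs (cP x) qx ux (subsetP Py _ uy).
have nvw u : u \in P v -> u \notin P w.
  move=> uv; apply/negP => uw; case/eqP: ij.
  have /subsetP wi := conn_sub_side (cP w) qw uw (subsetP Pv _ uv).
  exact: side_inj fT _ _ _ qi qj (wi _ jw).
have vw : v != w by apply/eqP => vw; have := nvw _ iv; rewrite -vw iv.
have adj s x y : q \in P x -> q \notin P y -> s \in P x -> s \in P y -> e x y.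
  by move=> qx qy sx sy; apply/(meet _ _ qx qy); exists s.
apply: colP => //.
- by rewrite !inE qv; apply/exists_inP; exists c; rewrite ?inE ?(adj i).
- by rewrite !inE qw; apply/exists_inP; exists c; rewrite ?inE ?(adj j).
apply/and5P; split=> //.
- by apply/negP => /(adjP v w vw) [u /nvw/negP].
- by apply/exists_inP; exists c; rewrite ?inE // (adj i) ?(adj j).
- by apply/exists_inP; exists a; rewrite ?inE // (adj i) //= (nmeet j).
- by apply/exists_inP; exists b; rewrite ?inE // (adj j) //= (nmeet i).
Qed.

(** * Splitting a node of large degree *)

(** Subtraction is truncated: a node of degree at most [h], such as the new node of degree 3 when
    [2 < h], counts for nothing. *)
Definition excess (U : finType) (f : rel U) h :=
  \sum_u (#|[set y | f u y]| - h).

Section Split.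
Variables (T : finType) (e : rel T) (U : finType) (f : rel U).
Variable P : T -> {set U}.
Hypothesis eP : rep e f P.
Variables (h : nat) (q i j : U).
Hypotheses (h2 : 2 < h) (kP : loc_colorable f P h).
Hypotheses (fqi : f q i) (fqj : f q j) (ij : i != j).
Hypothesis nij : forall v, ~ [/\ q \in P v, i \in P v & j \in P v].

Let fT : tree f. Proof. by case: eP. Qed.
Let cP v : conn f (P v). Proof. by case: eP. Qed.
Let fS : symmetric f. Proof. by case: fT. Qed.
Let fI : irreflexive f. Proof. by case: fT. Qed.

Let s := [pred u : U | (u == i) || (u == j)].
Let fs u : u \in s -> f q u. Proof. by case/orP => /eqP ->. Qed.

(* The new node [None] is joined to [q], [i], [j], replacing the edges [q i] and
   [q j]. *)
Let old : rel U := [rel a b | [&& f a b, ~~ ((a == q) && (b \in s))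
                               & ~~ ((b == q) && (a \in s))]].
Let g : rel (option U) := fun a b =>
  match a, b with
  | Some a, Some b => old a b
  | None, Some u | Some u, None => (u == q) || (u \in s)
  | None, None => false
  end.
Let Q v : {set option U} := [set a | if a is Some u then u \in P v
  else (q \in P v) && ((i \in P v) || (j \in P v))].

Let gS : symmetric g.
Proof. by case=> [a|] [b|] //=; rewrite /old /= fS andbA andbAC -andbA. Qed.

(** A replaced edge becomes two steps through [None]; every other edge survives. *)
Let map_edge (r : rel (option U)) a b : f a b ->
  (old a b -> r (Some a) (Some b)) ->
  (forall u v, u \in [:: a; b] -> v \in [:: a; b] -> u = q -> v \in s ->
     [/\ r (Some u) None, r None (Some u), r (Some v) None & r None (Some v)]) ->
  connect r (Some a) (Some b).
Proof.
move=> fab oab sab; case: (boolP (old a b)) => [/oab|]; first exact: connect1.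
rewrite /old /= fab /= negb_and !negbK => /orP [] /andP [/eqP uq us].
  have [] := sab a b _ _ uq us; rewrite ?inE ?eqxx ?orbT // => r1 _ _ r2.
  exact: connect_trans (connect1 r1) (connect1 r2).
have [] := sab b a _ _ uq us; rewrite ?inE ?eqxx ?orbT // => _ r1 r2 _.
exact: connect_trans (connect1 r2) (connect1 r1).
Qed.

Let tree_g : tree g.
Proof.
have gCS a b : connect g (Some a) (Some b).
  case: fT => _ _ /(_ a b) + _; apply: connect_homo => c d fcd.
  by apply: map_edge => // u v _ _ -> vs; rewrite /g eqxx vs orbT.
have gCN a : connect g None (Some a).
  by apply: connect_trans (gCS q a); apply: connect1; rewrite /= eqxx.
have cutf a b : f a b -> exists S, cut f a b S by case: fT => _ _ _; apply.
have symcut a b : (exists S, cut g a b S) -> exists S, cut g b a S.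
  by case=> S /(cutC gS); exists (~: S).
(* The cut of [q b] in [f] is reused, with [None] on the side of [q]. *)
have cut_s b : b \in s -> exists S, cut g None (Some b) S.
  move=> bs; case: (cutf _ _ (fs bs)) => S [qS bS H].
  exists [set u | if u is Some u then u \in S else true]; split; rewrite ?inE //.
  move=> [c|] [d|]; rewrite !inE //= => cS dS.
    case/and3P=> fcd n1 _; case: (H _ _ cS dS fcd) => cq db.
    by rewrite cq db eqxx bs in n1.
  case/orP=> [/eqP dq|ds]; first by rewrite dq qS in dS.
  by case: (H _ _ qS dS (fs ds)) => _ ->.
(* Intersect the cuts of [q i] and [q j], leaving [None] outside. *)
have cut_q : exists S, cut g (Some q) None S.
  case: (cutf _ _ fqi) => S [qS iS HS]; case: (cutf _ _ fqj) => R [qR jR HR].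
  exists [set u | if u is Some u then (u \in S) && (u \in R) else false].
  split; rewrite ?inE ?qS ?qR //.
  move=> [c|] [d|]; rewrite !inE //= => /andP [cS cR].
    rewrite negb_and => dSR /and3P [fcd n1 _].
    case/orP: dSR => [dS|dR].
      case: (HS _ _ cS dS fcd) => cq di; move: n1.
      by rewrite cq di !inE !eqxx.
    case: (HR _ _ cR dR fcd) => cq dj; move: n1.
    by rewrite cq dj !inE !eqxx orbT.
  move=> _ /orP [/eqP -> //|/orP [] /eqP cE].
    by rewrite cE (negPf iS) in cS.
  by rewrite cE (negPf jR) in cR.
split=> //.
- by case=> [a|] //=; rewrite /old /= fI.
- case=> [a|] [b|] //; first by rewrite (sym_connect_sym gS).
case=> [a|] [b|] //=.
- case/and3P=> fab n1 n2; case: (cutf _ _ fab) => S [aS bS H].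
  exists [set u | if u is Some u then u \in S else q \in S].
  split; rewrite ?inE //.
  move=> [c|] [d|]; rewrite !inE //= => cS dS.
  + by case/and3P=> fcd _ _; case: (H _ _ cS dS fcd) => -> ->.
  + case/orP=> [/eqP cq|cs]; first by rewrite -cq cS in dS.
    have fcq : f c q by rewrite fS fs.
    by case: (H _ _ cS dS fcq) => ca qb; rewrite -ca -qb eqxx cs in n2.
  + case/orP=> [/eqP dq|ds]; first by rewrite dq cS in dS.
    by case: (H _ _ cS dS (fs ds)) => qa db; rewrite -qa -db eqxx ds in n1.
- by case/orP=> [/eqP -> //|/cut_s/symcut].
- by case/orP=> [/eqP ->|/cut_s//]; apply: symcut.
Qed.

Let conn_Q v : conn g (Q v).
Proof.
have S1 a b : a \in P v -> b \in P v -> connect (rel_in g (Q v)) (Some a) (Some b).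
  move=> aP bP; move/connP: (cP v) => /(_ _ _ aP bP).
  apply: connect_homo => c d /and3P [cPv dP fcd]; apply: map_edge => // [ocd|u w uP wP uq ws].
    by rewrite rel_inE !inE cPv dP.
  have uv : u \in P v by move: uP; rewrite !inE => /orP [] /eqP ->.
  have wv : w \in P v by move: wP; rewrite !inE => /orP [] /eqP ->.
  have Nv : (q \in P v) && ((i \in P v) || (j \in P v)).
    rewrite -uq uv /=; case/orP: (ws) => /eqP wE; rewrite -wE wv ?orbT //.
  by rewrite !rel_inE !inE Nv uv wv /= uq eqxx ws orbT.
have S2 a : a \in Q v -> exists2 b, b \in P v &
    connect (rel_in g (Q v)) a (Some b) /\ connect (rel_in g (Q v)) (Some b) a.
  case: a => [a|]; rewrite inE => aP; first by exists a.
  have qP : q \in P v by case/andP: aP.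
  by exists q => //; split; apply: connect1; rewrite rel_inE !inE aP qP /= eqxx.
apply/connP => a b /S2 [c cPv [ac _]] /S2 [d dP [_ db]].
exact: connect_trans ac (connect_trans (S1 _ _ cPv dP) db).
Qed.

(** Undoes the split around [u]: seen from [q], [None] stands for the one of [i], [j] on the path;
    seen from [i] or [j], for [q]. This is injective on neighbours, so degrees inside paths do not
    grow. *)
Let back v u (a : option U) : U :=
  if a is Some b then b else
  if u == q then (if i \in P v then i else j) else q.

Let back_in v u a : a \in Q v -> g (Some u) a ->
  f u (back v u a) /\ back v u a \in P v.
Proof.
case: a => [b|]; rewrite !inE /=; first by move=> bP /and3P [].
case/andP=> qP ijP; case: eqVneq => [-> _|uq /=].
  by case: ifP ijP => //= iP; rewrite ?fqi ?fqj.
by move=> /fs; rewrite fS.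
Qed.

Let back_inj v u a b : g (Some u) a -> g (Some u) b ->
  back v u a = back v u b -> a = b.
Proof.
case: a b => [a|] [b|] //=; first by move=> _ _ ->.
- case/and3P=> _ n1 n2 uqs; case: eqVneq => uq ab; last first.
    by move: uqs n2; rewrite (negPf uq) ab eqxx /= => ->.
  move: n1; rewrite uq eqxx ab /=; case: ifP; rewrite !inE eqxx ?orbT //.
- move=> uqs /and3P [_ n1 n2]; case: eqVneq => uq ab; last first.
    by move: uqs n2; rewrite (negPf uq) -ab eqxx /= => ->.
  by move: n1; rewrite uq eqxx -ab /=; case: ifP; rewrite !inE eqxx ?orbT.
Qed.

Let rep_g : rep e g Q.
Proof.
case: (eP) => _ _ nP degP adjP; split=> //.
- by move=> v; case/set0Pn: (nP v) => u uP; apply/set0Pn; exists (Some u); rewrite inE.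
- move=> v [x|] a b c [xP aP bP cPv] [xa xb xc] [ab bc ca].
    rewrite inE in xP.
    have [[fa a1] [fb b1]] := (back_in aP xa, back_in bP xb).
    have [fc c1] := back_in cPv xc.
    apply: (degP v x (back v x a) (back v x b) (back v x c)) => //.
    by split; apply/eqP => /back_inj E; [move: ab|move: bc|move: ca];
      rewrite E ?eqxx.
  apply: (nij (v := v)).
  (* Three distinct neighbours of [None] exhaust [q], [i], [j], which contradicts [nij]. *)
  have H : [&& Some q \in [:: a; b; c], Some i \in [:: a; b; c]
             & Some j \in [:: a; b; c]].
    pose r := [:: Some q; Some i; Some j].
    have Ur : uniq [:: a; b; c].
      by rewrite /= !inE negb_or ab (eq_sym a) ca bc.
    have sub : {subset [:: a; b; c] <= r}.
      by move=> y; rewrite !inE => /or3P [] /eqP ->; move: xa xb xc;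
        [case: a {ab ca aP Ur}|case: b {ab bc bP Ur}|case: c {bc ca cPv Ur}].
    have [_ E] := uniq_min_size Ur sub (leqnn 3).
    by rewrite !E !inE !eqxx ?orbT.
  have Qin y : y \in [:: a; b; c] -> y \in Q v.
    move=> yabc; have : [|| y == a, y == b | y == c] by move: yabc; rewrite !inE.
    by case/or3P=> /eqP ->.
  by case/and3P: H => /Qin + /Qin + /Qin; rewrite !inE.
- move=> v w /adjP [H1 H2]; split.
    by case/H1=> u uv uw; exists (Some u); rewrite inE.
  case=> -[u|]; rewrite !inE => uv uw; apply: H2; first by exists u.
  by case/andP: uv => qv _; case/andP: uw => qw _; exists q.
Qed.

Hypothesis kij : exists k : U -> 'I_h,
  k i = k j /\ forall a b, loc f P q a b -> k a != k b.

Let loc_g : loc_colorable g Q h.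
Proof.
case=> [u|]; last first.
  have h0 := ltn_trans (isT : 0 < 2) h2; have h1 := ltn_trans (isT : 1 < 2) h2.
  (* At [None], [i] and [j] may share a colour, as no path uses both. *)
  exists (fun a => if a == Some q then Ordinal h0 else Ordinal h1).
  move=> [a|] [b|] /locP [[ga gb ab] [v [Nv av bv]]] //.
  move: Nv av bv; rewrite !inE => /andP [qv _] av bv.
  case: (eqVneq (Some a)) => [[aq]|aq]; case: (eqVneq (Some b)) => [[bq]|bq] //.
    by rewrite aq bq eqxx in ab.
  have gN c : g None (Some c) -> Some c != Some q -> c = i \/ c = j.
    by case/or3P=> /eqP ->; rewrite ?eqxx //; [left|right].
  exfalso; apply: (nij (v := v)).
  by case: (gN a ga aq) ab av => ->; case: (gN b gb bq) bv => ->; rewrite ?eqxx.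
have [k [kE kU]] : exists k : U -> 'I_h, (u = q -> k i = k j) /\
    forall a b, loc f P u a b -> k a != k b.
  case: (eqVneq u q) => [->|uq]; first by case: kij => k [kE kU]; exists k.
  by case: (kP u) => k kU; exists k; split=> // uq'; rewrite uq' eqxx in uq.
(* At [q], [None] inherits the common colour of [i] and [j], so it does not matter which of them
   [back] returns. *)
exists (fun a => k (if a is Some b then b else if u == q then i else q)).
move=> a b /locP [[ua ub ab] [v [uv av bv]]].
have kb c : k (if c is Some b then b else if u == q then i else q) = k (back v u c).
  by case: c => //=; case: eqVneq => // uq; case: ifP => // _; rewrite kE.
rewrite !kb; apply: kU; apply/locP.
have [fa aP] := back_in av ua; have [fb bP] := back_in bv ub.
split; last by exists v; rewrite inE in uv.
by split=> //; apply: contra ab => /eqP /(back_inj ua ub) ->.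
Qed.

Let excess_g : h < #|[set y | f q y]| -> excess g h < excess f h.
Proof.
move=> hq.
(* A version of [back] free of any path. It embeds the new neighbours of [u] into the old ones and
   at [q] misses [j], so the degree of [q] drops. *)
pose b0 u (a : option U) := if a is Some b then b else if u == q then i else q.
have b0_in u a : g (Some u) a -> f u (b0 u a).
  case: a => [b|] /=; first by case/and3P.
  by case: eqVneq => [-> //|uq /= /fs]; rewrite fS.
have b0_inj u : {in [set a | g (Some u) a] &, injective (b0 u)}.
  move=> [a|] [b|]; rewrite !inE //=; first by move=> _ _ ->.
  - case/and3P=> _ n1 n2 uqs; case: eqVneq => uq ab.
      by move: n1; rewrite uq eqxx ab !inE eqxx.
    by move: uqs n2; rewrite (negPf uq) ab eqxx /= !inE => ->.
  - move=> uqs /and3P [_ n1 n2]; case: eqVneq => uq ab.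
      by move: n1; rewrite uq eqxx -ab !inE eqxx.
    by move: uqs n2; rewrite (negPf uq) -ab eqxx /= !inE => ->.
have deg u : #|[set a | g (Some u) a]| <= #|[set y | f u y]|.
  rewrite -(card_in_imset (b0_inj u)); apply: subset_leq_card.
  by apply/subsetP => y /imsetP [a]; rewrite inE => /b0_in fa ->; rewrite inE.
have degq : #|[set a | g (Some q) a]| < #|[set y | f q y]|.
  rewrite -(card_in_imset (b0_inj q)); apply: proper_card; apply/properP; split.
    by apply/subsetP => y /imsetP [a]; rewrite inE => /b0_in fa ->; rewrite inE.
  exists j; rewrite ?inE //; apply/negP => /imsetP [[a|]]; rewrite inE /= ?eqxx.
    by case/and3P=> _ + _ ja; rewrite -ja eqxx !inE eqxx orbT.
  by move=> _ ji; move: ij; rewrite ji eqxx.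
have degN : #|[set a | g None a]| <= h.
  apply: leq_trans h2; apply: leq_trans (card_size [:: Some q; Some i; Some j]).
  by apply: subset_leq_card; apply/subsetP => -[a|]; rewrite !inE.
rewrite /excess (bigD1 None) //= (eqP degN) add0n.
rewrite (reindex_onto Some (odflt q)) /=; last by case.
rewrite (eq_bigl xpredT); last by move=> u; rewrite /= eqxx.
rewrite (bigD1 q) //= [X in _ < X](bigD1 q) //= -addSn; apply: leq_add.
  by rewrite ltn_sub2r.
by apply: leq_sum => u _; apply: leq_sub2r (deg u).
Qed.

Lemma split_rep : h < #|[set y | f q y]| ->
  exists (W : finType) (g' : rel W) (R : T -> {set W}),
    [/\ rep e g' R, loc_colorable g' R h & excess g' h < excess f h].
Proof. by move=> hq; exists (option U), g, Q; split=> //; apply: excess_g. Qed.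

End Split.

Lemma bounded_rep (T : finType) (e : rel T) (U : finType) (f : rel U)
    (P : T -> {set U}) h : 2 < h -> rep e f P -> loc_colorable f P h ->
  exists (W : finType) (g : rel W) (R : T -> {set W}),
    rep e g R /\ forall x, #|[set y | g x y]| <= h.
Proof.
move=> h2; have [n] := ubnP (excess f h); elim: n U f P => // n IHn U f P fn eP kP.
case: (boolP [forall x, #|[set y | f x y]| <= h]) => [/forallP H|].
  by exists U, f, P.
rewrite negb_forall => /existsP [q]; rewrite -ltnNge => hq.
case: (kP q) => k kq.
(* Pigeonhole: more than [h] neighbours share [h] colours. Two of equal colour are used together by
   no path through [q], so they can be split off. *)
have /dinjectivePn [i qi [j /andP [ji qj] kij]] :
    ~~ dinjectiveb k [set y | f q y].
  apply/negP => /dinjectiveP kinj; move: hq.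
  by rewrite -(card_in_imset kinj) ltnNge -[h in X in _ <= X]card_ord max_card.
rewrite !inE in qi qj ji.
have nij v : ~ [/\ q \in P v, i \in P v & j \in P v].
  case=> qv iv jv; suff /kq : loc f P q i j by rewrite kij eqxx.
  by apply/locP; rewrite eq_sym; split=> //; exists v.
have ij : i != j by rewrite eq_sym.
have [|W [g] [R] [eR kR lt]] := split_rep eP h2 kP qi qj ij nij _ hq.
  by exists k.
by apply: IHn eR kR; apply: leq_trans lt _.
Qed.

(** * Return to ordinal nodes, and conclusion *)

Lemma rep_has_rep (T : finType) (e : rel T) (U : finType) (f : rel U)
    (P : T -> {set U}) h : 0 < #|T| -> rep e f P ->
  (forall x, #|[set y | f x y]| <= h) -> has_rep e (Some h) 2 1.
Proof.
case/card_gt0P => v0 _ [fT cP nP degP adjP] fh.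
pose g : rel 'I_#|U| := fun a b => f (enum_val a) (enum_val b).
have gT : tree g.
  case: fT => fS fI fC fcut; split.
  - by move=> a b; apply: fS.
  - by move=> a; apply: fI.
  - move=> a b; rewrite -(enum_valK a) -(enum_valK b).
    apply: connect_homo (fC (enum_val a) (enum_val b)) => c d fcd.
    by apply: connect1; rewrite /g !enum_rankK.
  move=> a b /fcut [S [aS bS H]]; exists [set u | enum_val u \in S].
  split; rewrite ?inE // => c d; rewrite !inE => cS dS /(H _ _ cS dS) [cE dE].
  by split; apply: enum_val_inj.
exists #|U|, g, (fun v => [set a | enum_val a \in P v]); split.
- case: (gT) => gS gI gC _; split=> //; last exact: tree_acyclic.
  by case/set0Pn: (nP v0) => u _; apply/card_gt0P; exists u.
- move=> x; apply: leq_trans (fh (enum_val x)).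
  rewrite -(card_imset _ enum_val_inj); apply: subset_leq_card.
  by apply/subsetP => _ /imsetP [a + ->]; rewrite !inE.
- move=> v; split.
    by case/set0Pn: (nP v) => u uP; apply/set0Pn; exists (enum_rank u);
      rewrite inE enum_rankK.
  move=> a b; rewrite !inE => aP bP; rewrite -(enum_valK a) -(enum_valK b).
  move/connP: (cP v) => /(_ _ _ aP bP); apply: connect_homo => c d.
  case/and3P=> cPv dP fcd; apply: connect1.
  by rewrite rel_inE !inE /g !enum_rankK cPv dP.
- move=> v x; rewrite inE => xP; rewrite leqNgt; apply/negP => /card_gt2P.
  case=> a [b] [c]; rewrite !inE => -[[/andP [aP xa] /andP [bP xb] /andP [cPv xc]]].
  case=> ab bc ca; apply: (degP v (enum_val x) (enum_val a) (enum_val b) (enum_val c)) => //.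
  by rewrite !(inj_eq enum_val_inj).
- move=> v w /adjP [H1 H2]; rewrite card_gt0; split.
    case/H1=> u uv uw; apply/set0Pn; exists (enum_rank u).
    by rewrite !inE enum_rankK uv.
  by case/set0Pn=> u; rewrite !inE => /andP [uv uw]; apply: H2; exists (enum_val u).
Qed.

Lemma max_chi_branch_leq (T : finType) (e : rel T) h :
  (max_chi_branch e <= h) <->
  forall C, is_clique e C -> colorable (Bset e C) (Brel e C) h.
Proof.
split=> [/bigmax_leqP H C /H|H]; first by rewrite chi_leq.
by apply/bigmax_leqP => C /H; rewrite chi_leq.
Qed.

Lemma has_rep_max_chi (T : finType) (e : rel T) h : 0 < #|T| -> 0 < h ->
  has_rep e (Some h) 2 1 -> max_chi_branch e <= h.
Proof.
move=> T0 h0 hr; case: (has_rep_rep hr) => U [f] [P] [eP fh]; apply/max_chi_branch_leq => C.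
exact: branch_colorable eP _ _ T0 h0 fh.
Qed.

Lemma max_chi_has_rep (T : finType) (e : rel T) h : 0 < #|T| -> 2 < h ->
  VPT e -> max_chi_branch e <= h -> has_rep e (Some h) 2 1.
Proof.
move=> T0 h2 eV /max_chi_branch_leq Mh.
case: (@has_rep_rep _ e None eV) => U0 [f0] [P0] [eP0 _].
case: (reduced_rep eP0) => U [f] [P] [eP red].
have kP := reduced_loc_colorable (ltnW h2) eP red Mh.
by case: (bounded_rep h2 eP kP) => W [g] [R] [eR gh]; apply: rep_has_rep eR gh.
Qed.

(** For [3 <= h], a representation of degree [h] exists exactly when [max_chi_branch e <= h]. The
    equivalence uses this at [h] and [h.-1], hence [4 <= h]; for 3, excluding degree 2 takes only
    the bound [up], valid for all positive degrees. *)
Theorem mainTheorem5 (T : finType) (e : rel T)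
  (e_sym : symmetric e) (e_irr : irreflexive e)
  (T_ne : 0 < #|T|) (e_conn : forall x y, connect e x y)
  (G_VPT : VPT e) :
  (forall h : nat, 4 <= h ->
     ((has_rep e (Some h) 2 1 /\ ~ has_rep e (Some h.-1) 2 1)
      <-> max_chi_branch e = h))
  /\ (max_chi_branch e = 3 ->
      has_rep e (Some 3) 2 1 /\ ~ has_rep e (Some 2) 2 1).
Proof.
have up h : 0 < h -> has_rep e (Some h) 2 1 -> max_chi_branch e <= h.
  exact: has_rep_max_chi.
have down h : 2 < h -> max_chi_branch e <= h -> has_rep e (Some h) 2 1.
  by move=> h2; apply: max_chi_has_rep.
split=> [[|h] //|M3]; last by split; [apply: down|move/(up 2 isT)]; rewrite ?M3.
rewrite ltnS /= => h3; split=> [[/(up _ (ltn0Sn h)) Mh nM]|Mh].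
  apply/eqP; rewrite eqn_leq Mh ltnNge; apply/negP => /(down _ h3); exact: nM.
split; first by apply: down; rewrite ?Mh // ltnW.
by move/(up _ (ltn_trans (isT : 0 < 2) h3)); rewrite Mh ltnn.
Qed.
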